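(* Let $H\neq0$ be a Hermitian matrix of order $n\ge2$. Let $(H^{(k)},k\ge0)$ be generated by the Jacobi-type process $H^{(0)}=H$, $H^{(k+1)}=F_k^*H^{(k)}F_k$, $k\ge0$, where each $F_k=(f^{(k)}_{rs})$ is an elementary plane matrix acting in the $(i(k),j(k))$ plane, $i(k)<j(k)$. Suppose: (A1) the pivot strategy is generalized serial, i.e. $(i(k),j(k))=I_{\mathcal{O}}(k)$ for all $k$, for some $\mathcal{O}\in\mathcal{C}_{sg}^{(n)}$; (A2) there is a sequence of unitary elementary plane matrices $(U_k,k\ge0)$ with $\lim_{k\to\infty}(F_k-U_k)=0$; (A3) $\liminf_{k\to\infty}|f^{(k)}_{i(k)i(k)}|>0$; (A4) the sequence $(H^{(k)},k\ge0)$ is bounded. Then the following are equivalent: (i) $\lim_{k\to\infty}|h^{(k+1)}_{i(k)j(k)}|=0$, where $H^{(k+1)}=(h^{(k+1)}_{rs})$; (ii) $\lim_{k\to\infty}S(H^{(k)})=0$.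
   Context: $S(X)=\|X-\mathrm{diag}(X)\|_F$. An elementary plane matrix is a nonsingular $n\times n$ matrix that differs from $I_n$ only in one $2\times2$ principal submatrix; it acts in the $(i,j)$ plane if that submatrix lies in rows and columns $i,j$. Let $\mathcal{P}_n=\{(r,s):1\le r<s\le n\}$, $N=n(n-1)/2$; an ordering is a sequence listing each element of $\mathcal{P}_n$ exactly once. For an ordering $\mathcal{O}=(i_0,j_0),\dots,(i_{N-1},j_{N-1})$, the cyclic strategy is $I_{\mathcal{O}}(k)=(i_{k\bmod N},j_{k\bmod N})$. Relations on orderings: an admissible transposition swaps two adjacent pairs with disjoint index sets; $\mathcal{O}\sim\mathcal{O}'$ if one is obtained from the other by finitely many admissible transpositions; $\mathcal{O}\stackrel{\mathsf{s}}{\sim}\mathcal{O}'$ if $\mathcal{O}=[\mathcal{O}_1,\mathcal{O}_2]$, $\mathcal{O}'=[\mathcal{O}_2,\mathcal{O}_1]$ (concatenation); $\mathcal{O}\stackrel{\mathsf{w}}{\sim}\mathcal{O}'$ if there is a chain $\mathcal{O}=\mathcal{O}_0,\dots,\mathcal{O}_r=\mathcal{O}'$ of orderings whose adjacent terms are $\sim$ or $\stackrel{\mathsf{s}}{\sim}$; the chain is in canonical form if these relations alternate between $\sim$ and $\stackrel{\mathsf{s}}{\sim}$. $\mathcal{O}\stackrel{\mathsf{p}}{\sim}\mathcal{O}'$ if for some permutation $\mathsf{q}$ of $\{1,\dots,n\}$, $\mathcal{O}'$ arises by replacing each pair $(i_k,j_k)$ by the pair with entries $\mathsf{q}(i_k),\mathsf{q}(j_k)$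 in increasing order. $\mathcal{C}_c^{(n)}$: orderings $(1,2),(\tau_3(1),3),(\tau_3(2),3),\dots,(\tau_n(1),n),\dots,(\tau_n(n-1),n)$, $\tau_j$ a permutation of $\{1,\dots,j-1\}$; $\mathcal{C}_r^{(n)}$: orderings $(n-1,n),(n-2,\tau_{n-2}(n-1)),(n-2,\tau_{n-2}(n)),\dots,(1,\tau_1(2)),\dots,(1,\tau_1(n))$, $\tau_i$ a permutation of $\{i+1,\dots,n\}$; $\overleftarrow{\mathcal{C}}_c^{(n)},\overleftarrow{\mathcal{C}}_r^{(n)}$ the sets of orderings whose reversed sequences lie in $\mathcal{C}_c^{(n)}$, $\mathcal{C}_r^{(n)}$; $\mathcal{C}_{sp}^{(n)}=\mathcal{C}_c^{(n)}\cup\overleftarrow{\mathcal{C}}_c^{(n)}\cup\mathcal{C}_r^{(n)}\cup\overleftarrow{\mathcal{C}}_r^{(n)}$. $\mathcal{C}_{sg}^{(n)}$ (generalized serial orderings) is the set of orderings $\mathcal{O}$ with $\mathcal{O}\stackrel{\mathsf{p}}{\sim}\mathcal{O}'\stackrel{\mathsf{w}}{\sim}\mathcal{O}''$ or $\mathcal{O}\stackrel{\mathsf{w}}{\sim}\mathcal{O}'\stackrel{\mathsf{p}}{\sim}\mathcal{O}''$ for some ordering $\mathcal{O}'$ and some $\mathcal{O}''\in\mathcal{C}_{sp}^{(n)}$, the weak equivalence given in canonical form. *)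

(* Defs.v *)
From HB Require Import structures.
From mathcomp Require Import all_boot all_order all_algebra all_fingroup.
From mathcomp Require Import complex.
From mathcomp Require Import all_classical all_reals all_analysis.

Set Implicit Arguments.
Unset Strict Implicit.
Unset Printing Implicit Defensive.

Import Order.TTheory GRing.Theory Num.Theory.
Local Open Scope ring_scope.
Local Open Scope sesquilinear_scope.

Definition cmod (R : realType) (z : R[i]) : R := ComplexField.Normc.normc z.

Definition off_norm (R : realType) (n : nat) (X : 'M[R[i]]_n) : R :=
  Num.sqrt (\sum_(r < n) \sum_(s < n | r != s) cmod (X r s) ^+ 2).

Definition elem_plane (R : realType) (n : nat) (F : 'M[R[i]]_n) (i j : 'I_n)
  : Prop :=
  (i < j)%N /\ F \in unitmx /\
  forall r s : 'I_n, ~~ ((r \in [:: i; j]) && (s \in [:: i; j])) ->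
    F r s = (r == s)%:R.

Definition pairs_n (n : nat) : seq ('I_n * 'I_n) :=
  [seq (r, s) | r : 'I_n <- enum 'I_n, s : 'I_n <- [seq s : 'I_n <- enum 'I_n | (r < s)%N]].

Definition is_ordering (n : nat) (O : seq ('I_n * 'I_n)) : Prop :=
  perm_eq O (pairs_n n).

Inductive rt_chain (T : Type) (Rel : T -> T -> Prop) : T -> T -> Prop :=
  | rt_refl x : rt_chain Rel x x
  | rt_step x y z : Rel x y -> rt_chain Rel y z -> rt_chain Rel x z.

Definition adm_transp (n : nat) (O O' : seq ('I_n * 'I_n)) : Prop :=
  exists (s1 s2 : seq ('I_n * 'I_n)) (a b : 'I_n * 'I_n),
    O = s1 ++ a :: b :: s2 /\ O' = s1 ++ b :: a :: s2 /\
    [&& a.1 != b.1, a.1 != b.2, a.2 != b.1 & a.2 != b.2].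

Definition equiv_ord (n : nat) (O O' : seq ('I_n * 'I_n)) : Prop :=
  rt_chain (@adm_transp n) O O'.

Definition shift_equiv (n : nat) (O O' : seq ('I_n * 'I_n)) : Prop :=
  exists O1 O2, O = O1 ++ O2 /\ O' = O2 ++ O1.

Definition weak_equiv (n : nat) (O O' : seq ('I_n * 'I_n)) : Prop :=
  rt_chain (fun X Y => equiv_ord X Y \/ shift_equiv X Y) O O'.

Definition relabel (n : nat) (q : 'S_n) (p : 'I_n * 'I_n) : 'I_n * 'I_n :=
  let x := q p.1 in let y := q p.2 in
  if (x < y)%N then (x, y) else (y, x).

Definition perm_equiv (n : nat) (O O' : seq ('I_n * 'I_n)) : Prop :=
  exists q : 'S_n, O' = map (relabel q) O.

Definition natO (n : nat) (O : seq ('I_n * 'I_n)) : seq (nat * nat) :=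
  map (fun p => (nat_of_ord p.1, nat_of_ord p.2)) O.

(* C_c^(n) (0-based): column j = 1..n-1 lists (tau_j(0), j), ..., (tau_j(j-1), j) *)
Definition col_cyclic (n : nat) (O : seq (nat * nat)) : Prop :=
  exists cols : seq (seq nat),
    size cols = n.-1 /\
    (forall j, (j < n.-1)%N -> perm_eq (nth [::] cols j) (iota 0 j.+1)) /\
    O = flatten [seq [seq (a, j.+1) | a <- nth [::] cols j] | j <- iota 0 n.-1].

(* C_r^(n) (0-based): rows i = n-2 down to 0, row i lists
   (i, tau_i(i+1)), ..., (i, tau_i(n-1)) *)
Definition row_cyclic (n : nat) (O : seq (nat * nat)) : Prop :=
  exists rows : seq (seq nat),
    size rows = n.-1 /\
    (forall i, (i < n.-1)%N -> perm_eq (nth [::] rows i) (iota i.+1 (n - i.+1))) /\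
    O = flatten [seq [seq (i, b) | b <- nth [::] rows i] | i <- rev (iota 0 n.-1)].

Definition serial_sp (n : nat) (O : seq ('I_n * 'I_n)) : Prop :=
  col_cyclic n (natO O) \/ col_cyclic n (rev (natO O)) \/
  row_cyclic n (natO O) \/ row_cyclic n (rev (natO O)).

Definition gen_serial (n : nat) (O : seq ('I_n * 'I_n)) : Prop :=
  is_ordering O /\
  exists O' O'' : seq ('I_n * 'I_n), serial_sp O'' /\
    ((perm_equiv O O' /\ weak_equiv O' O'') \/
     (weak_equiv O O' /\ perm_equiv O' O'')).

Definition cyclic_strategy (n : nat) (O : seq ('I_n * 'I_n))
  (piv : nat -> 'I_n * 'I_n) : Prop :=
  forall k, Some (piv k) = onth O (k %% (n * n.-1)./2).

(* Main.v *)
Require Import Defs.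
From HB Require Import structures.
From mathcomp Require Import all_boot all_order all_algebra all_fingroup.
From mathcomp Require Import complex ring.
From mathcomp Require Import all_classical all_reals all_analysis.
Import Order.TTheory GRing.Theory Num.Theory.
Import numFieldNormedType.Exports.
Set Implicit Arguments.
Unset Strict Implicit.
Unset Printing Implicit Defensive.
Local Open Scope classical_set_scope.
Local Open Scope ring_scope.
Local Open Scope sesquilinear_scope.

(* Given (i) and a window length W, let s be the upper limit of S(H^(k))^2, and
   take limits, along an ultrafilter, of the matrices H^(k), F_k over windows of
   length W at whose right end S^2 tends to s. By (A2)-(A4) these limits follow
   an exact process X' = U^* X U, with U unitary in the pivot plane and nonzero
   diagonal entries there, that annihilates every pivot. Such a step lowers S^2
   by |x_ij|^2 + |x_ji|^2; as S^2 is at most s at the left end and equals s at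
   the right end, no step lowers it: the pivots also vanish before each step.
   Processes of this kind are reversible in time and compatible with swapping
   disjoint pivots, with cyclic shifts (at the cost of one more sweep) and with
   relabelling, so it is enough to treat a column-wise or row-wise sweep.
   There, if the leading block is diagonal when column j is reached, each
   rotation only multiplies a not yet visited entry of column j by a nonzero
   number, so that entry, which is zero when visited, was zero from the start,
   and by induction X is diagonal. Hence s = 0. *)

(** * Conjugation by matrices that act in a coordinate plane *)

Section PlaneMatrices.
Variables (C : numClosedFieldType) (n : nat).
Implicit Types (U V X Y Z M : 'M[C]_n) (i j r s p q : 'I_n).

Definition in_plane i j U := forall r s : 'I_n,
  ~~ ((r \in [:: i; j]) && (s \in [:: i; j])) -> U r s = (r == s)%:R.

Lemma in_planeC i j U : in_plane i j U -> in_plane j i U.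
Proof.
move=> Up r s rs; apply: Up; move: rs.
by rewrite !inE ![(_ == i) || _]orbC.
Qed.

Lemma trmxCE U r s : (U^t*) r s = (U s r)^*.
Proof. by rewrite !mxE. Qed.

Lemma trmxC_mul X Y : (X *m Y)^t* = Y^t* *m X^t*.
Proof. by rewrite trmx_mul map_mxM. Qed.

Lemma in_plane_trmxC i j U : in_plane i j U -> in_plane i j (U^t*).
Proof.
move=> Up r s rs; rewrite trmxCE Up; last by rewrite andbC.
by rewrite eq_sym conjC_nat.
Qed.

Lemma mulmx_plane_out i j U M r s : in_plane i j U -> s \notin [:: i; j] ->
  (M *m U) r s = M r s.
Proof.
move=> Up sij; rewrite mxE (bigD1 s) //= Up ?(negbTE sij) ?andbF // eqxx mulr1.
rewrite big1 ?addr0 // => t ts.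
by rewrite Up ?(negbTE sij) ?andbF // (negbTE ts) mulr0.
Qed.

Lemma mulmx_plane_in i j U M r s : i != j -> in_plane i j U ->
  s \in [:: i; j] -> (M *m U) r s = M r i * U i s + M r j * U j s.
Proof.
move=> ij Up sij; rewrite mxE (bigD1 i) //= (bigD1 j) /=; last by rewrite eq_sym.
rewrite addrA big1 ?addr0 // => t /andP[ti tj].
have tij : t \notin [:: i; j] by rewrite !inE negb_or ti tj.
rewrite Up ?(negbTE tij) //; case: eqP tij => [->|_ _]; first by rewrite sij.
by rewrite mulr0.
Qed.

Lemma conj_plane_out i j U X p q : in_plane i j U ->
  p \notin [:: i; j] -> q \notin [:: i; j] -> (U^t* *m X *m U) p q = X p q.
Proof.
move=> Up pij qij; rewrite (mulmx_plane_out _ _ Up) //.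
(* The left factor becomes a right factor by writing [U^t* *m X] as the adjoint of [X^t* *m U], so
   the column formula serves for rows too. *)
rewrite -[X in LHS]trmxCK -trmxC_mul trmxCE (mulmx_plane_out _ _ Up) //.
by rewrite trmxCE conjCK.
Qed.

Lemma conj_plane_col i j U X p s : i != j -> in_plane i j U ->
  p \notin [:: i; j] -> s \in [:: i; j] ->
  (U^t* *m X *m U) p s = X p i * U i s + X p j * U j s.
Proof.
move=> ij Up pij sij; rewrite (mulmx_plane_in _ _ ij Up) //.
by rewrite -[X in LHS]trmxCK -trmxC_mul !trmxCE !(mulmx_plane_out _ _ Up) //
           !trmxCE !conjCK.
Qed.

Lemma conj_trmxC U X : (U^t* *m X *m U)^t* = U^t* *m X^t* *m U.
Proof. by rewrite !trmxC_mul trmxCK mulmxA. Qed.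

Lemma conj_plane_row i j U X p s : i != j -> in_plane i j U ->
  p \notin [:: i; j] -> s \in [:: i; j] ->
  (U^t* *m X *m U) s p = (U i s)^* * X i p + (U j s)^* * X j p.
Proof.
move=> ij Up pij sij; rewrite -[LHS]conjCK -(trmxCE (U^t* *m X *m U)) conj_trmxC.
rewrite (conj_plane_col _ ij Up) // !trmxCE rmorphD !rmorphM /= !conjCK.
by rewrite ![X _ _ * _]mulrC.
Qed.

(** [U - 1] and [V - 1] live on disjoint index sets, so their product is zero; expanding it gives
    the formula. Its symmetry in [U] and [V] is what yields commutation. *)
Lemma mulmx_disjoint_planes i j p q U V : in_plane i j U -> in_plane p q V ->
  [&& i != p, i != q, j != p & j != q] -> U *m V = U + V - 1%:M.
Proof.
move=> Up Vp dis.
have UV0 : (U - 1%:M) *m (V - 1%:M) = 0.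
  apply/matrixP => r s; rewrite !mxE big1 // => t _.
  rewrite !mxE; case: (boolP (t \in [:: i; j])) => [tij|tij].
    have tpq : t \notin [:: p; q].
      move: tij dis; rewrite !inE => /orP[]/eqP ->.
        by case/and4P => /negbTE -> /negbTE ->.
      by case/and4P => _ _ /negbTE -> /negbTE ->.
    by rewrite Vp ?(negbTE tpq) // subrr mulr0.
  by rewrite Up ?(negbTE tij) ?andbF // subrr mul0r.
rewrite -[RHS]add0r -UV0 mulmxBr !mulmxBl !(mulmx1, mul1mx) opprB -!addrA.
by rewrite addKr [X in _ + (_ + X)]addrCA subrr addr0 addNr addr0.
Qed.

Lemma disjoint_pairsC i j p q :
  [&& i != p, i != q, j != p & j != q] -> [&& p != i, p != j, q != i & q != j].
Proof.
by case/and4P=> ip iq jp jq; rewrite ![_ == i]eq_sym ![_ == j]eq_sym ip iq jp.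
Qed.

Lemma disjoint_planes_comm i j p q U V : in_plane i j U -> in_plane p q V ->
  [&& i != p, i != q, j != p & j != q] -> U *m V = V *m U.
Proof.
move=> Up Vp dis; rewrite (mulmx_disjoint_planes Up Vp dis).
by rewrite (mulmx_disjoint_planes Vp Up (disjoint_pairsC dis)) [U + V]addrC.
Qed.

End PlaneMatrices.

(** * Relations composed along a list of labels *)

Fixpoint chain (T S : Type) (st : T -> S -> S -> Prop) (L : seq T) (x y : S) :=
  if L is a :: L' then exists2 z, st a x z & chain st L' z y else x = y.

Lemma chain_cat (T S : Type) (st : T -> S -> S -> Prop) L1 L2 x y :
  chain st (L1 ++ L2) x y <-> exists2 z, chain st L1 x z & chain st L2 z y.
Proof.
elim: L1 x => [|a L1 IH] x /=.
  by split=> [xy|[z ->]]; first exists x.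
split=> [[w aw /IH[z wz zy]]|[z [w aw wz] zy]].
  by exists z => //; exists w.
by exists w => //; apply/IH; exists z.
Qed.

Lemma chain_map (T T' S S' : Type) (st : T -> S -> S -> Prop)
    (st' : T' -> S' -> S' -> Prop) (f : T -> T') (g : S -> S') L x y :
  (forall a u v, st a u v -> st' (f a) (g u) (g v)) ->
  chain st L x y -> chain st' (map f L) (g x) (g y).
Proof.
move=> fg; elim: L x => [|a L IH] x /= => [->//|[z az zy]].
by exists (g z); [exact: fg | exact: IH].
Qed.

Lemma chain_rev (T S : Type) (st : T -> S -> S -> Prop) L x y :
  (forall a u v, st a u v -> st a v u) -> chain st L x y -> chain st (rev L) y x.
Proof.
move=> stC; elim: L x => [|a L IH] x //= [z az zy].
rewrite rev_cons -cats1; apply/chain_cat; exists z; first exact: IH.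
by exists x => //; apply: stC.
Qed.

(** * Stationary Jacobi steps and sweeps over serial orderings *)

Section StationarySteps.
Variables (C : numClosedFieldType) (n : nat).
Implicit Types (U V X Y Z M : 'M[C]_n) (i j r s p q : 'I_n) (a b : 'I_n * 'I_n).

Definition pivot0 a X := X a.1 a.2 = 0 /\ X a.2 a.1 = 0.

(* A Jacobi step that neither finds nor leaves anything at its pivot: these
   are the steps of the limit of the process along an ultrafilter. *)
Definition stat_step a X Y := exists2 U,
  [/\ a.1 != a.2, U \is unitarymx, in_plane a.1 a.2 U,
      U a.1 a.1 != 0 & U a.2 a.2 != 0] &
  [/\ Y = U^t* *m X *m U, pivot0 a X & pivot0 a Y].

(** The adjoint rotation undoes the step, and the pivot condition is imposed on both sides, so it
    survives the exchange. *)
Lemma stat_step_sym a X Y : stat_step a X Y -> stat_step a Y X.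
Proof.
case=> U [a12 Uu Up U1 U2] [-> X0 Y0]; exists (U^t*).
  split; rewrite ?trmxC_unitary ?trmxCE ?conjC_eq0 //.
  exact: in_plane_trmxC.
split=> //; rewrite trmxCK !mulmxA (unitarymxP Uu) mul1mx -mulmxA.
by rewrite (unitarymxP Uu) mulmx1.
Qed.

Lemma stat_step_swap i j X Y : stat_step (i, j) X Y -> stat_step (j, i) X Y.
Proof.
case=> U /= [a12 Uu Up U1 U2] [YE [X1 X2] [Y1 Y2]]; exists U; split=> //=.
  by rewrite eq_sym.
exact: in_planeC.
Qed.

(** The two rotations commute, and each one fixes the pivot entries of the other, so all four pivot
    conditions carry over to the new intermediate matrix. *)
Lemma stat_step_transp a b X Z :
  [&& a.1 != b.1, a.1 != b.2, a.2 != b.1 & a.2 != b.2] ->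
  forall Y, stat_step a X Y -> stat_step b Y Z ->
  exists2 Y', stat_step b X Y' & stat_step a Y' Z.
Proof.
move=> dis Y [U [a12 Uu Up U1 U2] [YE aX aY]] [V [b12 Vu Vp V1 V2] [ZE bY bZ]].
have UV := disjoint_planes_comm Up Vp dis.
have disC := disjoint_pairsC dis.
have out (x y z t : 'I_n) : [&& x != z, x != t, y != z & y != t] ->
    (x \notin [:: z; t]) && (y \notin [:: z; t]).
  by move=> /and4P[xz xt yz yt]; rewrite !inE !negb_or xz xt yz yt.
have [a1 a2] := andP (out _ _ _ _ dis).
have [b1 b2] := andP (out _ _ _ _ disC).
have ZE' : Z = U^t* *m (V^t* *m X *m V) *m U.
  by rewrite ZE YE !mulmxA -trmxC_mul UV trmxC_mul -!mulmxA UV.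
exists (V^t* *m X *m V).
  exists V; split=> //.
    by case: bY; rewrite YE /pivot0 !(conj_plane_out _ Up).
  by case: bZ; rewrite ZE' /pivot0 !(conj_plane_out _ Up).
exists U; split=> //.
  by case: aX; rewrite /pivot0 !(conj_plane_out _ Vp).
by case: aY; rewrite ZE /pivot0 !(conj_plane_out _ Vp).
Qed.

(** The predicate is on [nat] so that index sets can be the lists of naturals occurring in
    [col_cyclic] and [row_cyclic]. *)
Definition diag_on (P : pred nat) X :=
  forall r s, P r -> P s -> r != s -> X r s = 0.

(** An entry with one index in the plane becomes a combination of two old off-diagonal entries, both
    zero; the two entries inside the plane are the new pivot. *)
Lemma stat_step_diag_on (P : pred nat) a X Y :
  P a.1 -> P a.2 -> stat_step a X Y -> diag_on P X -> diag_on P Y.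
Proof.
move=> P1 P2 [U [a12 Uu Up U1 U2] [YE aX aY]] dX r s Pr Ps rs.
have [rin|rout] := boolP (r \in [:: a.1; a.2]);
    have [sin|sout] := boolP (s \in [:: a.1; a.2]).
- case: aY => Y12 Y21; move: rin sin rs; rewrite !inE.
  by move=> /orP[] /eqP -> /orP[] /eqP ->; rewrite ?eqxx.
- rewrite YE (conj_plane_row _ a12 Up) //.
  move: sout; rewrite !inE negb_or => /andP[s1 s2].
  by rewrite !dX ?mulr0 ?addr0 // eq_sym.
- rewrite YE (conj_plane_col _ a12 Up) //.
  move: rout; rewrite !inE negb_or => /andP[r1 r2].
  by rewrite !dX ?mul0r ?addr0.
- by rewrite YE (conj_plane_out _ Up) ?dX.
Qed.

(** Labels are pairs of naturals, in either order, to match the serial orderings and to let rows be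
    read as columns. *)
Definition stat_stepn (a : nat * nat) X Y := exists i j : 'I_n,
  a = (val i, val j) /\ stat_step (i, j) X Y.

Lemma stat_stepn_swap (i j : nat) X Y :
  stat_stepn (i, j) X Y -> stat_stepn (j, i) X Y.
Proof. by case=> i' [j' [[-> ->] /stat_step_swap st]]; exists j', i'. Qed.

Lemma chain_stepn O X Y :
  chain stat_step O X Y -> chain stat_stepn (natO O) X Y.
Proof.
apply: (@chain_map _ _ _ _ _ _ _ id) => -[i j] u v st.
by exists i, j.
Qed.

Lemma chain_stepn_diag_on (P : pred nat) (L : seq (nat * nat)) X Y :
  (forall a : nat * nat, a \in L -> P a.1 && P a.2) ->
  chain stat_stepn L X Y -> diag_on P X -> diag_on P Y.
Proof.
elim: L X => [|a L IH] X PL /= => [->//|[Z [i [j [aE st]]] zy] dX].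
have := PL a (mem_head _ _); rewrite aE /= => /andP[Pi Pj].
apply: IH zy _; first by move=> b bL; apply: PL; rewrite inE bL orbT.
exact: stat_step_diag_on st dX.
Qed.

(* The pivot column is rescaled at each step by the nonzero diagonal entry of
   the rotation, so an entry that vanishes when its turn comes was zero from
   the start. *)
Lemma column_chain_zero (l : seq nat) (j : nat) X Y : uniq l -> j \notin l ->
  diag_on [in l] X -> chain stat_stepn [seq (t, j) | t <- l] X Y ->
  forall p (k : 'I_n), (p : nat) \in l -> k = j :> nat -> X p k = 0 /\ X k p = 0.
Proof.
elim: l X => [//|r l IH] X /= /andP[rl ul]; rewrite inE negb_or => /andP[jr jl].
move=> dX [Z [i [j' [[rE jE] [U /= [ij Uu Up U1 U2] [ZE X0 Z0]]]] zy] p k pl kj].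
have {kj}-> : k = j' by apply/val_inj; rewrite /= kj jE.
have [->|pi] := eqVneq p i; first exact: X0.
have {}pl : val p \in l.
  by move: pl; rewrite inE rE => /orP[/eqP/val_inj pE|//]; rewrite pE eqxx in pi.
have out q : val q \in l -> q \notin [:: i; j'].
  move=> ql; rewrite !inE negb_or; apply/andP; split.
    by apply: contraNneq rl => qi; rewrite rE -qi.
  by apply: contraNneq jl => qj; rewrite jE -qj.
have dZ : diag_on [in l] Z.
  move=> s t sl tl st; rewrite ZE (conj_plane_out _ Up) ?out // dX //.
    by rewrite inE sl orbT.
  by rewrite inE tl orbT.
have [Zpk Zkp] := IH Z ul jl dZ zy p j' pl (esym jE).
have j'in : j' \in [:: i; j'] by rewrite !inE eqxx orbT.
have il : val i \in r :: l by rewrite inE rE eqxx.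
have pl' : val p \in r :: l by rewrite inE pl orbT.
move: Zpk Zkp.
rewrite ZE (conj_plane_col _ ij Up) ?out // (conj_plane_row _ ij Up) ?out //.
(* The summand mixed in from column or row [i] lies off the diagonal of the block, hence is zero;
   what remains is a multiple by [U j' j'] or its conjugate. *)
rewrite (dX p i) // (dX i p) //; last by rewrite eq_sym.
rewrite mul0r mulr0 !add0r => /eqP; rewrite mulf_eq0 (negbTE U2) orbF => /eqP ->.
by move=> /eqP; rewrite mulf_eq0 conjC_eq0 (negbTE U2) => /eqP ->.
Qed.

(** By [column_chain_zero] the enlarged block is diagonal already at the start, and every step of
    the chain acts inside it. *)
Lemma column_chain_diag (l : seq nat) (j : nat) X Y : uniq l -> j \notin l ->
  diag_on [in l] X -> chain stat_stepn [seq (t, j) | t <- l] X Y ->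
  diag_on [in j :: l] Y.
Proof.
move=> ul jl dX xy; apply: chain_stepn_diag_on (xy) _.
  by move=> _ /mapP[r rl ->]; rewrite /= !inE eqxx rl orbT.
move=> r s; rewrite !inE => /orP[/eqP rj|rl] /orP[/eqP sj|sl] rs.
- by move: rs; rewrite -(inj_eq val_inj) /= rj sj eqxx.
- by have [] := column_chain_zero ul jl dX xy sl rj.
- by have [] := column_chain_zero ul jl dX xy rl sj.
- exact: dX.
Qed.

Lemma row_chain_diag (l : seq nat) (i : nat) X Y : uniq l -> i \notin l ->
  diag_on [in l] X -> chain stat_stepn [seq (i, t) | t <- l] X Y ->
  diag_on [in i :: l] Y.
Proof.
move=> ul jl dX xy; apply: column_chain_diag (ul) jl dX _.
pose sw (a : nat * nat) := (a.2, a.1).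
suff -> : [seq (t, i) | t <- l] = map sw [seq (i, t) | t <- l].
  by apply: chain_map xy => -[u v] A B; apply: stat_stepn_swap.
by rewrite -map_comp; apply: eq_map.
Qed.

Lemma eq_diag_on (P Q : pred nat) X : P =1 Q -> diag_on P X -> diag_on Q X.
Proof. by move=> PQ dX r s; rewrite -!PQ; apply: dX. Qed.

Lemma col_cyclic_diag O X Y :
  col_cyclic n O -> chain stat_stepn O X Y -> diag_on predT Y.
Proof.
move=> [cols [_ [colP ->]]] xy.
(* Induction on the number [m] of columns swept: the leading block of order [m.+1] is then diagonal,
   starting from order one. *)
suff: forall m, (m <= n.-1)%N -> forall Z, chain stat_stepn
    (flatten [seq [seq (t, h.+1) | t <- nth [::] cols h] | h <- iota 0 m]) X Z ->
    diag_on [pred k | (k < m.+1)%N] Z.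
  move=> /(_ _ (leqnn _) _ xy) dY r s _ _; apply: dY => /=.
    by rewrite (leq_trans (ltn_ord r)) // leqSpred.
  by rewrite (leq_trans (ltn_ord s)) // leqSpred.
elim=> [_ Z _ r s /= |m IH mn Z].
  rewrite !ltnS !leqn0 => /eqP r0 /eqP s0.
  by rewrite -(inj_eq val_inj) /= r0 s0.
rewrite -(addn1 m) iotaD map_cat flatten_cat /= cats0 add0n.
case/chain_cat=> W xW WZ; have colm := colP m mn.
apply: eq_diag_on (column_chain_diag _ _ _ WZ).
- move=> k; rewrite /= inE (perm_mem colm) mem_iota /= add0n addn1.
  by rewrite [RHS]ltnS [RHS]leq_eqVlt.
- by rewrite (perm_uniq colm) iota_uniq.
- by rewrite (perm_mem colm) mem_iota /= ltnn.
- apply: eq_diag_on (IH (ltnW mn) _ xW) => k.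
  by rewrite /= (perm_mem colm) mem_iota.
Qed.

Lemma row_cyclic_diag O X Y :
  row_cyclic n O -> chain stat_stepn O X Y -> diag_on predT Y.
Proof.
move=> [rows [_ [rowP ->]]] xy.
(* Here the trailing block grows: after the [c] rows from [n - 2] up to [i], the block of indices at
   least [i] is diagonal; for [c = 0] it is the last index alone. *)
suff: forall c i : nat, (i + c = n.-1)%N -> forall Z, chain stat_stepn
    (flatten [seq [seq (h, t) | t <- nth [::] rows h] | h <- rev (iota i c)]) X Z ->
    diag_on [pred k | (i <= k)%N] Z.
  by move=> /(_ n.-1 0%N erefl _ xy) dY r s _ _; apply: dY.
elim=> [|c IH] i ic Z.
  move=> _ r s /=; move: ic; rewrite addn0 => -> nr ns rs.
  have last_ord (t : 'I_n) : (n.-1 <= t)%N -> t = n.-1 :> nat.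
    move=> nt; apply/eqP; rewrite eqn_leq nt andbT -ltnS prednK //.
    exact: leq_ltn_trans (ltn_ord t).
  by move: rs; rewrite -(inj_eq val_inj) /= (last_ord r) // (last_ord s) ?eqxx.
rewrite /= rev_cons map_rcons -cats1 flatten_cat /= cats0.
case/chain_cat=> W xW WZ.
have iN : (i < n.-1)%N by rewrite -ic addnS ltnS leq_addr.
have in' : (i.+1 < n)%N by move: iN; rewrite ltn_predRL.
have rowi := rowP i iN.
have memr k : (k < n)%N -> (k \in nth [::] rows i) = (i < k)%N.
  by move=> kn; rewrite (perm_mem rowi) mem_iota subnKC ?kn ?andbT // ltnW.
move=> r s /= ir is_ rs; apply: (row_chain_diag _ _ _ WZ); rewrite ?inE ?memr //.
- by rewrite (perm_uniq rowi) iota_uniq.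
- by rewrite ltnn.
- exact: ltnW.
- move=> p q; rewrite /= !memr //; apply: (IH i.+1 _ _ xW).
  by rewrite addSnnS.
- by rewrite eq_sym -leq_eqVlt.
- by rewrite eq_sym -leq_eqVlt.
Qed.


(** * Orderings whose repeated stationary sweeps must start at a diagonal matrix *)

Lemma chain_diag L X Y : chain stat_step L X Y -> diag_on predT X -> diag_on predT Y.
Proof.
elim: L X => [|a L IH] X /= => [->//|[Z st zy] dX].
by apply: IH zy _; apply: stat_step_diag_on st dX.
Qed.

Lemma chain_diag_rev L X Y :
  chain stat_step L X Y -> diag_on predT Y -> diag_on predT X.
Proof. by move=> /(chain_rev stat_step_sym) /chain_diag. Qed.

Definition repeat_ord m (O : seq ('I_n * 'I_n)) := flatten (nseq m O).

(** The number [m] of sweeps is left free because each cyclic shift uses up one more. *)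
Definition forces_diag (O : seq ('I_n * 'I_n)) := exists m,
  forall X Y, chain stat_step (repeat_ord m O) X Y -> diag_on predT X.

Lemma chain_repeat (g : 'M[C]_n -> 'M[C]_n) m O O' X Y :
  (forall X Y, chain stat_step O X Y -> chain stat_step O' (g X) (g Y)) ->
  chain stat_step (repeat_ord m O) X Y ->
  chain stat_step (repeat_ord m O') (g X) (g Y).
Proof.
move=> OO'; elim: m X => [|m IH] X /= => [->//|].
case/chain_cat=> Z XZ ZY; apply/chain_cat; exists (g Z); first exact: OO'.
exact: IH.
Qed.

(** One sweep suffices. A column or row sweep ends at a diagonal matrix, and diagonality travels
    back to the start; for a reversed ordering the sweep is run backwards, and so ends at [X]. *)
Lemma serial_forces_diag O : serial_sp O -> forces_diag O.
Proof.
move=> Os; exists 1%N => X Y; rewrite /repeat_ord /= cats0 => xy.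
have xyn := chain_stepn xy; have yxn := chain_stepn (chain_rev stat_step_sym xy).
case: Os => [|[|[|]]] Oc.
- by apply: chain_diag_rev xy _; apply: col_cyclic_diag Oc xyn.
- by apply: (col_cyclic_diag Oc (X := Y)); rewrite /natO -map_rev.
- by apply: chain_diag_rev xy _; apply: row_cyclic_diag Oc xyn.
- by apply: (row_cyclic_diag Oc (X := Y)); rewrite /natO -map_rev.
Qed.

Lemma equiv_chain O O' X Y :
  equiv_ord O O' -> chain stat_step O X Y -> chain stat_step O' X Y.
Proof.
elim=> // {}O O1 O2 [s1 [s2 [a [b [-> [-> dis]]]]]] _ IH xy; apply: IH.
case/chain_cat: xy => Z xZ /= [V aV [W bW wy]].
apply/chain_cat; exists Z => //=.
have [V' bV' aW] := stat_step_transp dis aV bW.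
by exists V' => //; exists W.
Qed.

Lemma equiv_forces_diag O O' : equiv_ord O O' -> forces_diag O' -> forces_diag O.
Proof.
move=> OO' [m dO']; exists m => X Y xy; apply: (dO' X Y).
by apply: (@chain_repeat id) xy => U V; apply: equiv_chain.
Qed.

Lemma repeat_ord_shift m O1 O2 :
  repeat_ord m.+1 (O1 ++ O2) = O1 ++ repeat_ord m (O2 ++ O1) ++ O2.
Proof.
elim: m => [|m IH]; first by rewrite /repeat_ord /= cats0.
rewrite -[LHS]/((O1 ++ O2) ++ repeat_ord m.+1 (O1 ++ O2)) IH.
by rewrite -[repeat_ord m.+1 _]/((O2 ++ O1) ++ repeat_ord m (O2 ++ O1)) -!catA.
Qed.

(** After the prefix [s1], the [m.+1] sweeps contain [m] full sweeps of the shifted ordering, so the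
    matrix reached there is diagonal; reversing the prefix gives the same for [X]. *)
Lemma shift_forces_diag O O' :
  shift_equiv O O' -> forces_diag O' -> forces_diag O.
Proof.
case=> s1 [s2 [-> ->]] [m dm]; exists m.+1 => X Y.
rewrite repeat_ord_shift => /chain_cat[Z xZ /chain_cat[W zW _]].
exact: chain_diag_rev xZ (dm _ _ zW).
Qed.

Lemma weak_forces_diag O O' : weak_equiv O O' -> forces_diag O' -> forces_diag O.
Proof.
elim=> // {}O O1 O2 [OO1|OO1] _ IH dO2.
  exact: equiv_forces_diag OO1 (IH dO2).
exact: shift_forces_diag OO1 (IH dO2).
Qed.

(** This is conjugation by the permutation matrix of [t]; the inverse puts the entry at [(r, s)] in
    position [(t r, t s)]. *)
Definition perm_conj (t : 'S_n) X : 'M[C]_n :=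
  \matrix_(r, s) X ((t^-1)%g r) ((t^-1)%g s).

Lemma perm_conjM (t : 'S_n) X Y :
  perm_conj t (X *m Y) = perm_conj t X *m perm_conj t Y.
Proof.
apply/matrixP => r s; rewrite !mxE (reindex_inj (@perm_inj _ (t^-1)%g)).
by apply: eq_bigr => k _; rewrite !mxE.
Qed.

Lemma perm_conj_trmxC (t : 'S_n) X : perm_conj t (X^t*) = (perm_conj t X)^t*.
Proof. by apply/matrixP => r s; rewrite !mxE. Qed.

Lemma perm_conjE (t : 'S_n) X r s : perm_conj t X (t r) (t s) = X r s.
Proof. by rewrite mxE !permK. Qed.

Lemma stat_step_perm (t : 'S_n) a X Y : stat_step a X Y ->
  stat_step (t a.1, t a.2) (perm_conj t X) (perm_conj t Y).
Proof.
case=> U [a12 Uu Up U1 U2] [-> X0 Y0]; exists (perm_conj t U).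
  split; rewrite ?perm_conjE ?(inj_eq perm_inj) //.
    apply/unitarymxP; rewrite -perm_conj_trmxC -perm_conjM (unitarymxP Uu).
    by apply/matrixP => r s; rewrite !mxE (inj_eq perm_inj).
  move=> r s; rewrite -[r](permKV t) -[s](permKV t).
  move: ((t^-1)%g r) ((t^-1)%g s) => {}r {}s; rewrite perm_conjE !inE.
  by rewrite !(inj_eq perm_inj) => rs; apply: Up; rewrite !inE.
split; rewrite /pivot0 /= ?perm_conjE //.
by rewrite !perm_conjM perm_conj_trmxC.
Qed.

Lemma perm_forces_diag O O' : perm_equiv O O' -> forces_diag O' -> forces_diag O.
Proof.
move=> [t ->] [m dm]; exists m => X Y xy.
have {}xy : chain stat_step (repeat_ord m (map (relabel t) O))
    (perm_conj t X) (perm_conj t Y).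
  apply: chain_repeat xy => U V; apply: chain_map => -[i j] A B st.
  (* [relabel] sorts the image pair; when this reverses it, [stat_step_swap] absorbs the change. *)
  rewrite /relabel /=; case: ifP => _; first exact: (stat_step_perm t st).
  exact/stat_step_swap/(stat_step_perm t st).
move=> r s _ _ rs; rewrite -(perm_conjE t) (dm _ _ xy) //.
by rewrite (inj_eq perm_inj).
Qed.

Lemma gen_serial_forces_diag O : gen_serial O -> forces_diag O.
Proof.
case=> _ [L1 [L2 [/serial_forces_diag Os]]].
case=> -[]; first by move=> /perm_forces_diag p /weak_forces_diag w; apply/p/w.
by move=> /weak_forces_diag w /perm_forces_diag p; apply/w/p.
Qed.

End StationarySteps.

(** * Change of the off-diagonal mass under a unitary plane rotation *)

Section OffNorm.
Variables (C : numClosedFieldType) (n : nat).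
Implicit Types (U X Y : 'M[C]_n) (i j : 'I_n).

Definition frob2 X := \sum_(r < n) \sum_(s < n) `|X r s| ^+ 2.
Definition off2 X := \sum_(r < n) \sum_(s < n | r != s) `|X r s| ^+ 2.

Lemma frob2E X : frob2 X = \tr (X^t* *m X).
Proof.
rewrite /frob2 exchange_big; apply: eq_bigr => s _; rewrite mxE.
by apply: eq_bigr => r _; rewrite !mxE normCKC.
Qed.

Lemma frob2_unitary U X : U \is unitarymx -> frob2 (U^t* *m X *m U) = frob2 X.
Proof.
move=> Uu; rewrite !frob2E conj_trmxC !mulmxA -(mulmxA _ U) (unitarymxP Uu).
by rewrite mulmx1 mxtrace_mulC !mulmxA (unitarymxP Uu) mul1mx.
Qed.

Lemma frob2_off2 X : frob2 X = \sum_r `|X r r| ^+ 2 + off2 X.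
Proof.
rewrite -big_split; apply: eq_bigr => r _; rewrite (bigD1 r) //=.
by congr (_ + _); apply: eq_bigl => s; rewrite eq_sym.
Qed.

(** Compressing by this coordinate projector isolates the pivot block while staying among matrices
    of order [n], where [frob2_unitary] applies. *)
Definition plane_proj i j : 'M[C]_n := diag_mx (\row_k (k \in [:: i; j])%:R).

Lemma plane_projE i j X r s : (plane_proj i j *m X *m plane_proj i j) r s =
  if (r \in [:: i; j]) && (s \in [:: i; j]) then X r s else 0.
Proof.
rewrite mul_mx_diag mxE mul_diag_mx !mxE.
by case: (r \in _); case: (s \in _); rewrite ?mul1r ?mul0r ?mulr1 ?mulr0.
Qed.

Lemma plane_projC i j U : in_plane i j U ->
  plane_proj i j *m U = U *m plane_proj i j.
Proof.
move=> Up; rewrite mul_mx_diag mul_diag_mx; apply/matrixP => r s; rewrite !mxE.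
have [/andP[-> ->]|] := boolP ((r \in [:: i; j]) && (s \in [:: i; j])).
  by rewrite mul1r mulr1.
by move=> /Up ->; case: eqP => [->|_]; rewrite ?mulr1 ?mul1r // mulr0 mul0r.
Qed.

Lemma frob2_plane_proj i j X : i != j ->
  frob2 (plane_proj i j *m X *m plane_proj i j) =
  `|X i i| ^+ 2 + `|X i j| ^+ 2 + `|X j i| ^+ 2 + `|X j j| ^+ 2.
Proof.
move=> ij; have sum2 (f : 'I_n -> C) : (forall r, r \notin [:: i; j] -> f r = 0) ->
    \sum_r f r = f i + f j.
  move=> f0; rewrite (bigD1 i) //= (bigD1 j) /=; last by rewrite eq_sym.
  rewrite addrA big1 ?addr0 // => r /andP[ri rj].
  by apply: f0; rewrite !inE negb_or ri rj.
have iin : i \in [:: i; j] by rewrite !inE eqxx.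
have jin : j \in [:: i; j] by rewrite !inE eqxx orbT.
rewrite /frob2 sum2 ?sum2 ?plane_projE ?iin ?jin /= ?addrA //.
- by move=> r /negbTE rij; rewrite plane_projE rij andbF normr0 expr0n.
- by move=> r /negbTE rij; rewrite plane_projE rij andbF normr0 expr0n.
- move=> r /negbTE rij; rewrite big1 // => s _.
  by rewrite plane_projE rij normr0 expr0n.
Qed.

(** Two Frobenius norms are invariant: that of the whole matrix, and that of the pivot block,
    because its projector commutes with [U]. Diagonal entries outside the plane do not move, so
    subtracting the two invariances leaves this balance. *)
Lemma off2_conj_plane i j U X Y : i != j -> U \is unitarymx -> in_plane i j U ->
  Y = U^t* *m X *m U ->
  off2 Y + (`|X i j| ^+ 2 + `|X j i| ^+ 2) =
  off2 X + (`|Y i j| ^+ 2 + `|Y j i| ^+ 2).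
Proof.
move=> ij Uu Up YE.
have FE : frob2 Y = frob2 X by rewrite YE frob2_unitary.
have BE : frob2 (plane_proj i j *m Y *m plane_proj i j) =
          frob2 (plane_proj i j *m X *m plane_proj i j).
  rewrite YE -[RHS](frob2_unitary _ Uu) !mulmxA (plane_projC (in_plane_trmxC Up)).
  by rewrite -!mulmxA (plane_projC Up).
rewrite !frob2_plane_proj // in BE; move: FE; rewrite !frob2_off2.
have diagE (f : 'I_n -> C) :
    \sum_k f k = f i + (f j + \sum_(k | (k != i) && (k != j)) f k).
  by rewrite (bigD1 i) //= (bigD1 j) //= eq_sym.
rewrite !diagE.
have -> : \sum_(k | (k != i) && (k != j)) `|Y k k| ^+ 2 =
          \sum_(k | (k != i) && (k != j)) `|X k k| ^+ 2.
  apply: eq_bigr => k /andP[ki kj].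
  by rewrite YE (conj_plane_out _ Up) // !inE negb_or ki kj.
set D := \sum_(_ | _) _ => FE.
apply/eqP; rewrite -subr_eq0.
set F1 := (X in X = _) in FE; set F2 := (X in _ = X) in FE.
set B1 := (X in X = _) in BE; set B2 := (X in _ = X) in BE.
suff -> : off2 Y + (`|X i j| ^+ 2 + `|X j i| ^+ 2) -
  (off2 X + (`|Y i j| ^+ 2 + `|Y j i| ^+ 2)) = (F1 - F2) - (B1 - B2).
  by rewrite FE BE !subrr.
rewrite /F1 /F2 /B1 /B2; ring.
Qed.

End OffNorm.

(** * Exact processes that annihilate every pivot *)

Section ExactProcess.
Variables (C : numClosedFieldType) (n : nat).
Implicit Types (U X Y : 'M[C]_n) (i j : 'I_n).

(** If [U j j] were zero, orthogonality of columns [i] and [j] would force [U i j = 0], leaving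
    column [j] null. Thus a bound on the first diagonal entry controls both. *)
Lemma unitary_plane_diag i j U : i != j -> U \is unitarymx -> in_plane i j U ->
  U i i != 0 -> U j j != 0.
Proof.
move=> ij Uu Up Ui; apply/eqP => Uj.
have UU := mulmx1C (unitarymxP Uu).
have iin : i \in [:: i; j] by rewrite !inE eqxx.
have jin : j \in [:: i; j] by rewrite !inE eqxx orbT.
have := mulmx_plane_in (U^t*) i ij Up jin.
rewrite UU Uj mulr0 addr0 mxE (negbTE ij) trmxCE => /esym/eqP.
rewrite mulf_eq0 conjC_eq0 (negbTE Ui) => /eqP Uij.
have := mulmx_plane_in (U^t*) j ij Up jin.
rewrite UU Uj Uij !mulr0 addr0 mxE eqxx => /eqP.
by rewrite oner_eq0.
Qed.

Lemma off2_ge0 X : 0 <= off2 X.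
Proof. by apply: sumr_ge0 => r _; apply: sumr_ge0 => s _; rewrite exprn_ge0. Qed.

Lemma off2_eq0_diag X : off2 X = 0 <-> diag_on predT X.
Proof.
split=> [X0 r s _ _ rs|dX].
  have ge0 k : true -> 0 <= \sum_(s < n | k != s) `|X k s| ^+ 2.
    by move=> _; apply: sumr_ge0 => t _; rewrite exprn_ge0.
  have Xr : \sum_(s < n | r != s) `|X r s| ^+ 2 = 0 := psumr_eq0P ge0 X0 isT.
  have {}ge0 k : r != k -> 0 <= `|X r k| ^+ 2 by rewrite exprn_ge0.
  have /eqP : `|X r s| ^+ 2 = 0 := psumr_eq0P ge0 Xr rs.
  by rewrite expf_eq0 normr_eq0 => /eqP.
rewrite /off2 big1 // => r _; rewrite big1 // => s rs.
by rewrite dX // normr0 expr0n.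
Qed.

Lemma repeat_ordE a0 m (O : seq ('I_n * 'I_n)) :
  repeat_ord m O = [seq nth a0 O (k %% size O) | k <- iota 0 (m * size O)].
Proof.
elim: m => [//|m IH]; rewrite -[LHS]/(O ++ repeat_ord m O) IH mulSn iotaD map_cat.
congr (_ ++ _).
  rewrite -[LHS](mkseq_nth a0); apply/eq_in_map => k.
  by rewrite mem_iota => /andP[_ kO]; rewrite modn_small.
rewrite addnC iotaDl -map_comp; apply: eq_map => k /=.
by rewrite modnDl.
Qed.

Lemma chain_iota (T S : Type) (st : T -> S -> S -> Prop) (a : nat -> T)
    (x : nat -> S) m c :
  (forall k, (k < c + m)%N -> st (a k) (x k) (x k.+1)) ->
  chain st (map a (iota c m)) (x c) (x (c + m)%N).
Proof.
elim: m c => [c _|m IH c ax] /=; first by rewrite addn0.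
exists (x c.+1); first by apply: ax; rewrite addnS ltnS leq_addr.
by rewrite -addSnnS; apply: IH => k; rewrite addSnnS; apply: ax.
Qed.

(** [off2] can only decrease, so equality at the two ends makes every step of the window stationary.
    The window may exceed [m] sweeps, which lets its right end fall anywhere within a sweep. *)
Lemma exact_process_off2_eq0 O a0 : forces_diag C O -> exists m, forall W
    (Xs Us : nat -> 'M[C]_n), (m * size O <= W)%N ->
  (forall k, let a := nth a0 O (k %% size O) in
    [/\ a.1 != a.2, Us k \is unitarymx, in_plane a.1 a.2 (Us k) &
        Us k a.1 a.1 != 0]) ->
  (forall k, Xs k.+1 = (Us k)^t* *m Xs k *m Us k) ->
  (forall k, pivot0 (nth a0 O (k %% size O)) (Xs k.+1)) ->
  off2 (Xs 0%N) <= off2 (Xs W) -> off2 (Xs W) = 0.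
Proof.
case=> m dm; exists m => W Xs Us mW Usa XsS piv0 le0W.
pose a k := nth a0 O (k %% size O).
have drop k : off2 (Xs k) =
    off2 (Xs k.+1) + (`|Xs k (a k).1 (a k).2| ^+ 2 + `|Xs k (a k).2 (a k).1| ^+ 2).
  have [a12 Uu Up _] := Usa k.
  rewrite (off2_conj_plane a12 Uu Up (XsS k)).
  by have [-> ->] := piv0 k; rewrite normr0 expr0n /= !addr0.
have dropge0 k :
    0 <= `|Xs k (a k).1 (a k).2| ^+ 2 + `|Xs k (a k).2 (a k).1| ^+ 2.
  by rewrite addr_ge0 ?exprn_ge0.
have mono k l : (k <= l)%N -> off2 (Xs l) <= off2 (Xs k).
  elim: l => [|l IH]; first by rewrite leqn0 => /eqP ->.
  rewrite leq_eqVlt => /orP[/eqP -> //|]; rewrite ltnS => /IH; apply: le_trans.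
  by rewrite [leRHS]drop lerDl.
have piv0' k : (k < W)%N -> pivot0 (a k) (Xs k).
  move=> kW; have : off2 (Xs k) <= off2 (Xs k.+1).
    by rewrite (le_trans (mono 0%N k _)) // (le_trans le0W) // mono.
  rewrite drop gerDl => le0; have /andP := conj le0 (dropge0 k).
  rewrite -eq_le paddr_eq0 ?exprn_ge0 // !expf_eq0 !normr_eq0 /= => /andP[/eqP ? /eqP ?].
  by split.
apply/eqP; rewrite eq_le off2_ge0 andbT (le_trans (mono 0%N W _)) //.
suff -> : off2 (Xs 0%N) = 0 by [].
apply/off2_eq0_diag/(dm _ (Xs (m * size O)%N)).
rewrite (repeat_ordE a0) -[X in Xs X]add0n.
apply: chain_iota => k; rewrite add0n => kW.
have [a12 Uu Up U1] := Usa k; exists (Us k).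
  by split=> //; apply: unitary_plane_diag U1.
by split; [exact: XsS | apply: piv0'; exact: leq_trans kW mW | exact: piv0].
Qed.

End ExactProcess.

(** This identifies the period of [cyclic_strategy] with the length of an ordering. Reversing the
    row index turns the row lengths into [0, 1, ..., n - 1]. *)
Lemma size_pairs_n n : size (pairs_n n) = (n * n.-1)./2.
Proof.
rewrite -bin2 -bin2_sum big_mkord size_allpairs_dep sumnE big_map big_enum /=.
rewrite (reindex_inj rev_ord_inj) /=; apply: eq_bigr => r _.
rewrite -sum1_size big_filter big_enum_cond /= (reindex_inj rev_ord_inj) /=.
transitivity (\sum_(k < r) 1)%N; last by rewrite sum1_card card_ord.
rewrite (big_ord_widen n (fun=> 1%N) (ltnW (ltn_ord r))).
by apply: eq_bigl => k; rewrite ltn_sub2lE // ltnS.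
Qed.

(** * Limits of complex sequences along a filter, taken on real and imaginary parts *)

Section ComplexLimits.
Variable R : realType.
Implicit Types (F : set_system nat) (z w : nat -> R[i]).

Definition clim F z (l : R[i]) :=
  (fun k => complex.Re (z k)) @ F --> complex.Re l /\
  (fun k => complex.Im (z k)) @ F --> complex.Im l.

Lemma cmodE (x : R[i]) : `|x| = (cmod x)%:C%C.
Proof. by case: x. Qed.

Lemma cmod_ge0 (x : R[i]) : 0 <= cmod x.
Proof. by case: x => a b; apply: sqrtr_ge0. Qed.

Lemma cmod_sqr (x : R[i]) : cmod x ^+ 2 = complex.Re x ^+ 2 + complex.Im x ^+ 2.
Proof. by case: x => a b; rewrite /cmod /= sqr_sqrtr // addr_ge0 ?sqr_ge0. Qed.

Lemma ler_Re_cmod (x : R[i]) : `|complex.Re x| <= cmod x.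
Proof.
rewrite -(@ler_pXn2r _ 2) // ?nnegrE ?cmod_ge0 // cmod_sqr real_normK ?num_real //.
by rewrite lerDl sqr_ge0.
Qed.

Lemma ler_Im_cmod (x : R[i]) : `|complex.Im x| <= cmod x.
Proof.
rewrite -(@ler_pXn2r _ 2) // ?nnegrE ?cmod_ge0 // cmod_sqr real_normK ?num_real //.
by rewrite lerDr sqr_ge0.
Qed.

Lemma clim_cst F (l : R[i]) : Filter F -> clim F (fun=> l) l.
Proof. by move=> FF; split; apply: cvg_cst. Qed.

Lemma ReD (x y : R[i]) : complex.Re (x + y) = complex.Re x + complex.Re y.
Proof. by case: x y => ? ? []. Qed.

Lemma ImD (x y : R[i]) : complex.Im (x + y) = complex.Im x + complex.Im y.
Proof. by case: x y => ? ? []. Qed.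

Lemma ReM (x y : R[i]) : complex.Re (x * y) =
  complex.Re x * complex.Re y - complex.Im x * complex.Im y.
Proof. by case: x y => ? ? []. Qed.

Lemma ImM (x y : R[i]) : complex.Im (x * y) =
  complex.Re x * complex.Im y + complex.Im x * complex.Re y.
Proof. by case: x y => ? ? []. Qed.

Lemma Re_conj (x : R[i]) : complex.Re (x^*) = complex.Re x.
Proof. by case: x. Qed.

Lemma Im_conj (x : R[i]) : complex.Im (x^*) = - complex.Im x.
Proof. by case: x. Qed.

Lemma climD F z w l m : Filter F -> clim F z l -> clim F w m ->
  clim F (fun k => z k + w k) (l + m).
Proof.
move=> FF [zr zi] [wr wi]; split.
  by rewrite ReD; under eq_fun do rewrite ReD; apply: cvgD.
by rewrite ImD; under eq_fun do rewrite ImD; apply: cvgD.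
Qed.

Lemma climM F z w l m : Filter F -> clim F z l -> clim F w m ->
  clim F (fun k => z k * w k) (l * m).
Proof.
move=> FF [zr zi] [wr wi]; split.
  by rewrite ReM; under eq_fun do rewrite ReM; apply: cvgB; apply: cvgM.
by rewrite ImM; under eq_fun do rewrite ImM; apply: cvgD; apply: cvgM.
Qed.

Lemma clim_conj F z l : Filter F -> clim F z l -> clim F (fun k => (z k)^*) (l^*).
Proof.
move=> FF [zr zi]; split.
  by rewrite Re_conj; under eq_fun do rewrite Re_conj.
by rewrite Im_conj; under eq_fun do rewrite Im_conj; apply: cvgN.
Qed.

Lemma clim_sum F (I : finType) (z : I -> nat -> R[i]) (l : I -> R[i]) :
  Filter F -> (forall i, clim F (z i) (l i)) ->
  clim F (fun k => \sum_i z i k) (\sum_i l i).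
Proof.
move=> FF zl; elim: (index_enum I) => [|i s IH].
  by rewrite big_nil; under eq_fun do rewrite big_nil; apply: clim_cst.
by rewrite big_cons; under eq_fun do rewrite big_cons; apply: climD.
Qed.

Lemma clim_near_eq F z w l : Filter F -> (\forall k \near F, z k = w k) ->
  clim F z l -> clim F w l.
Proof.
move=> FF zw [zr zi]; split; [apply: cvg_trans zr | apply: cvg_trans zi];
  by apply: near_eq_cvg; apply: filterS zw => k ->.
Qed.

Lemma clim_unique F z l m : ProperFilter F -> clim F z l -> clim F z m -> l = m.
Proof.
move=> FF [zr zi] [wr wi].
have := cvg_unique (@Rhausdorff R) zr wr; have := cvg_unique (@Rhausdorff R) zi wi.
by case: l m {zr zi wr wi} => a b [c d] /= -> ->.
Qed.

(** Compactness of the segment gives a cluster point, and an ultrafilter converges to each of its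
    cluster points: a neighbourhood or its complement has preimage in [F]. *)
Lemma ultra_cvg_bounded F (u : nat -> R) (M : R) : UltraFilter F ->
  (forall k, `|u k| <= M) -> exists l : R, u @ F --> l.
Proof.
move=> UF uM; have PF := @ultra_proper _ _ UF.
have co := @segment_compact R (- M) M.
have [|l [_ lcl]] := co (u @ F) (fmap_proper_filter u PF).
  by apply: nearW => k; rewrite /= in_itv /= -ler_norml.
exists l => A lA; have [//|FnA] := in_ultra_setVsetC (u @^-1` A) UF.
by have [x [nAx Ax]] := lcl (~` A) A FnA lA.
Qed.

Lemma clim_bounded F z (M : R) : UltraFilter F ->
  (forall k, cmod (z k) <= M) -> exists l, clim F z l.
Proof.
move=> UF zM.
have [|a za] := @ultra_cvg_bounded F (fun k => complex.Re (z k)) M UF.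
  by move=> k; rewrite (le_trans (ler_Re_cmod _)).
have [|b zb] := @ultra_cvg_bounded F (fun k => complex.Im (z k)) M UF.
  by move=> k; rewrite (le_trans (ler_Im_cmod _)).
by exists (Complex a b).
Qed.

Lemma clim_cmod_sqr F z l : Filter F -> clim F z l ->
  (fun k => cmod (z k) ^+ 2) @ F --> cmod l ^+ 2.
Proof.
move=> FF [zr zi]; rewrite cmod_sqr; under eq_fun do rewrite cmod_sqr.
by apply: cvgD; apply: cvgM.
Qed.

Lemma clim_cmod0 F z : Filter F -> (fun k => cmod (z k)) @ F --> (0 : R) ->
  clim F z 0.
Proof.
move=> FF z0; split; apply: norm_cvg0;
  (apply: (squeeze_cvgr _ (cvg_cst 0) z0); apply: nearW => k; rewrite normr_ge0 /=).
  exact: ler_Re_cmod.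
exact: ler_Im_cmod.
Qed.

End ComplexLimits.

(** * Entrywise limits of matrices and of their off-diagonal mass *)

Section MatrixLimits.
Variables (R : realType) (n : nat).
Implicit Types (F : set_system nat) (A B : nat -> 'M[R[i]]_n) (X Y : 'M[R[i]]_n).

Definition mlim F A X := forall r s, clim F (fun k => A k r s) (X r s).

Lemma mlimM F A B X Y : Filter F -> mlim F A X -> mlim F B Y ->
  mlim F (fun k => A k *m B k) (X *m Y).
Proof.
move=> FF AX BY r s; rewrite mxE; under eq_fun do rewrite mxE.
by apply: clim_sum => t; apply: climM.
Qed.

Lemma mlim_trmxC F A X : Filter F -> mlim F A X -> mlim F (fun k => (A k)^t*) (X^t*).
Proof.
move=> FF AX r s; rewrite trmxCE; under eq_fun do rewrite trmxCE.
exact: clim_conj.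
Qed.

Lemma mlim_unique F A X Y : ProperFilter F -> mlim F A X -> mlim F A Y -> X = Y.
Proof.
move=> FF AX AY; apply/matrixP => r s.
exact: clim_unique (AX r s) (AY r s).
Qed.

Lemma mlim_near_eq F A B X : Filter F -> (\forall k \near F, A k = B k) ->
  mlim F A X -> mlim F B X.
Proof.
move=> FF AB AX r s; apply: clim_near_eq (AX r s).
by apply: filterS AB => k ->.
Qed.

Lemma mlim_bounded F A (M : R) : UltraFilter F ->
  (forall k r s, cmod (A k r s) <= M) -> exists X, mlim F A X.
Proof.
move=> UF AM.
have /choice[f fP] (rs : 'I_n * 'I_n) :
    exists l, clim F (fun k => A k rs.1 rs.2) l.
  by apply: (@clim_bounded _ _ _ M UF) => k.
exists (\matrix_(r, s) f (r, s)) => r s; rewrite mxE.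
exact: (fP (r, s)).
Qed.

Lemma mlim_sub0 F A B X : Filter F ->
  (forall r s, (fun k => cmod (B k r s - A k r s)) @ F --> (0 : R)) ->
  mlim F A X -> mlim F B X.
Proof.
move=> FF AB AX r s.
have := climD FF (clim_cmod0 FF (AB r s)) (AX r s); rewrite add0r.
by under eq_fun do rewrite subrK.
Qed.

Definition off_sqr X : R := \sum_(r < n) \sum_(s < n | r != s) cmod (X r s) ^+ 2.

Lemma off2E X : off2 X = (off_sqr X)%:C%C.
Proof.
rewrite /off2 /off_sqr rmorph_sum; apply: eq_bigr => r _.
rewrite rmorph_sum; apply: eq_bigr => s _.
by rewrite cmodE rmorphXn.
Qed.

Lemma off_sqr_ge0 X : 0 <= off_sqr X.
Proof.
by apply: sumr_ge0 => r _; apply: sumr_ge0 => s _; rewrite exprn_ge0 ?cmod_ge0.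
Qed.

Lemma cvg_sumr F (I : finType) (P : pred I) (f : I -> nat -> R) (l : I -> R) :
  Filter F -> (forall i, P i -> f i @ F --> l i) ->
  (fun k => \sum_(i | P i) f i k) @ F --> \sum_(i | P i) l i.
Proof.
move=> FF fl; elim: (index_enum I) => [|i s IH].
  by rewrite big_nil; under eq_fun do rewrite big_nil; apply: cvg_cst.
rewrite big_cons; under eq_fun do rewrite big_cons.
by case: ifP => // Pi; apply: cvgD => //; apply: fl.
Qed.

Lemma mlim_off_sqr F A X : Filter F -> mlim F A X ->
  (fun k => off_sqr (A k)) @ F --> off_sqr X.
Proof.
move=> FF AX; apply: cvg_sumr => r _; apply: cvg_sumr => s _.
exact: clim_cmod_sqr.
Qed.

(** Each row has norm one. This bound is what gives the unitary matrices of (A2) limits along an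
    ultrafilter. *)
Lemma cmod_unitary_le1 X r s : X \is unitarymx -> cmod (X r s) <= 1.
Proof.
move=> Xu; have /matrixP/(_ r r) := unitarymxP Xu; rewrite !mxE eqxx mulr1n => X1.
rewrite -(@ler_pXn2r _ 2) // ?nnegrE ?cmod_ge0 // expr1n.
rewrite -lecR rmorphXn /= -cmodE -[leRHS]/(1 : R[i]) -X1 (bigD1 s) //=.
rewrite !mxE -normCK lerDl.
by apply: sumr_ge0 => t _; rewrite !mxE -normCK exprn_ge0.
Qed.

End MatrixLimits.

(** * Upper and lower limits of real sequences in epsilon form *)

Section RealSequences.
Variable R : realType.
Implicit Types (u : nat -> R).

Lemma real_limsup u (M : R) : (forall k, 0 <= u k <= M) -> exists s : R,
  (forall e, 0 < e -> exists T, forall k, (T <= k)%N -> u k <= s + e) /\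
  (forall e T, 0 < e -> exists2 k, (T <= k)%N & s - e < u k).
Proof.
move=> u0M; pose A := [set a : R | exists T, forall k, (T <= k)%N -> u k <= a].
have AM : A M by exists 0%N => k _; have /andP[] := u0M k.
have lbA : has_lbound A.
  exists 0 => a [T Ta]; apply: le_trans (Ta T (leqnn T)).
  by have /andP[] := u0M T.
(* The upper limit is the infimum of the eventual upper bounds. *)
exists (inf A); split=> [e e0|e T e0].
  have [|a [T Ta] ae] := inf_adherent e0 (E := A); first by split=> //; exists M.
  by exists T => k /Ta /le_trans; apply; apply: ltW.
apply: contrapT => nk.
have /(ge_inf lbA) : A (inf A - e).
  exists T => k Tk; rewrite leNgt; apply/negP => lt; apply: nk.
  by exists k.
by rewrite lerDl oppr_ge0 leNgt e0.
Qed.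

Lemma limn_einf_gt0 u : (0 < limn_einf (fun k => (u k)%:E))%E ->
  exists2 c : R, 0 < c & exists T, forall k, (T <= k)%N -> c <= u k.
Proof.
rewrite limn_einf_lim (cvg_lim _ (@cvg_einfs_sup _ _)) //.
move=> /ereal_sup_gt[_ [T _ <-]] e0.
have lb k : (T <= k)%N -> (einfs (fun k => (u k)%:E) T <= (u k)%:E)%E.
  by move=> Tk; apply: ereal_inf_lbound; exists k.
(* The tail infimum is a real number: positivity excludes minus infinity, and the bound by [u T]
   excludes plus infinity. *)
have := lb T (leqnn T); case: einfs e0 lb => [c|//|//].
by rewrite lte_fin => c0 lb _; exists c => //; exists T => k /lb; rewrite lee_fin.
Qed.

End RealSequences.

(** Pigeonhole: the residue classes form a finite partition, so the ultrafilter contains one of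
    them. *)
Lemma ultra_modn (F : set_system nat) (kappa : nat -> nat) N : UltraFilter F ->
  (0 < N)%N -> exists2 rho, (rho < N)%N & \forall p \near F, (kappa p %% N)%N = rho.
Proof.
move=> UF N0; have PF := @ultra_proper _ _ UF.
apply: contrapT => nrho.
have /filter_forall : forall i : 'I_N, \forall p \near F, (kappa p %% N)%N != i.
  move=> i; have [Fi|] := in_ultra_setVsetC [set p | (kappa p %% N)%N = i] UF.
    by case: nrho; exists i.
  by apply: filterS => p /= /eqP.
move=> /filter_ex[p /(_ (Ordinal (ltn_pmod (kappa p) N0)))].
by rewrite eqxx.
Qed.

Lemma hermitian_conj (C : numClosedFieldType) n (X F : 'M[C]_n) :
  X^t* = X -> (F^t* *m X *m F)^t* = F^t* *m X *m F.
Proof. by move=> XE; rewrite conj_trmxC XE. Qed.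

Lemma off_norm_cvg0 (R : realType) n (A : nat -> 'M[R[i]]_n) :
  (forall e : R, 0 < e -> exists T, forall k, (T <= k)%N -> off_sqr (A k) <= e) ->
  (fun k => off_norm (A k)) @ \oo --> (0 : R).
Proof.
move=> Ae; apply/cvgrPdist_le => e e0.
have [T Te] := Ae (e ^+ 2) (exprn_gt0 _ e0).
exists T => // k /= /Te Ak; rewrite sub0r normrN ger0_norm ?sqrtr_ge0 //.
by rewrite -(ger0_norm (ltW e0)) -sqrtr_sqr ler_sqrt // exprn_ge0 ?ltW.
Qed.

Lemma cmod_le_off_norm (R : realType) n (X : 'M[R[i]]_n) r s : r != s ->
  cmod (X r s) <= off_norm X.
Proof.
move=> rs; rewrite -[leLHS]ger0_norm ?cmod_ge0 // -sqrtr_sqr.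
rewrite ler_sqrt ?off_sqr_ge0 // (bigD1 r) //= (bigD1 s) //= -addrA lerDl.
have ge0 (P : pred 'I_n) k : 0 <= \sum_(t | P t) cmod (X k t) ^+ 2.
  by apply: sumr_ge0 => t _; rewrite exprn_ge0 ?cmod_ge0.
by rewrite addr_ge0 ?ge0 // sumr_ge0.
Qed.

(** * Passing from the asymptotic process to its exact limit *)

Section AsymptoticProcess.
Variables (R : realType) (n : nat).
Variables (Hs Fs Us : nat -> 'M[R[i]]_n) (piv : nat -> 'I_n * 'I_n).
Variables (O : seq ('I_n * 'I_n)) (M c : R) (T0 : nat).
Hypothesis Hs_herm : forall k, (Hs k)^t* = Hs k.
Hypothesis HsS : forall k, Hs k.+1 = (Fs k)^t* *m Hs k *m Fs k.
Hypothesis Fs_neq : forall k, (piv k).1 != (piv k).2.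
Hypothesis Fs_plane : forall k, in_plane (piv k).1 (piv k).2 (Fs k).
Hypothesis O_gt0 : (0 < size O)%N.
Hypothesis piv_cyclic : forall a0 k, piv k = nth a0 O (k %% size O).
Hypothesis O_diag : forces_diag R[i] O.
Hypothesis Us_unitary : forall k, Us k \is unitarymx.
Hypothesis Fs_Us :
  forall r s, (fun k => cmod (Fs k r s - Us k r s)) @ \oo --> (0 : R).
Hypothesis c_gt0 : 0 < c.
Hypothesis Fs_diag :
  forall k, (T0 <= k)%N -> c <= cmod (Fs k (piv k).1 (piv k).1).
Hypothesis Hs_bounded : forall k r s, cmod (Hs k r s) <= M.
Hypothesis Hs_piv :
  (fun k => cmod (Hs k.+1 (piv k).1 (piv k).2)) @ \oo --> (0 : R).

Let a0 := piv 0.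
Let a k := nth a0 O (k %% size O).

Section UltraLimit.
Variables (F : set_system nat) (t : nat -> nat).
Hypothesis UF : UltraFilter F.
Hypothesis t_infty : t @ F --> \oo.
Hypothesis t_phase : \forall p \near F, (t p %% size O)%N = 0%N.
#[local] Instance PF : ProperFilter F := @ultra_proper _ _ UF.

Lemma near_t_ge N : \forall p \near F, (N <= t p)%N.
Proof. by have /t_infty := nbhs_infty_ge N. Qed.

Lemma shift_infty k : (fun p => (t p + k)%N) @ F --> \oo.
Proof.
move=> A [N _ NA]; apply: filterS (near_t_ge N) => p Np.
by apply: NA; rewrite /= (leq_trans Np) ?leq_addr.
Qed.

Lemma cvg_shift (u : nat -> R) (l : R) k :
  u @ \oo --> l -> (fun p => u (t p + k)%N) @ F --> l.
Proof. by move=> ul; apply: (cvg_comp _ _ (shift_infty k) ul). Qed.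

Lemma near_piv k : \forall p \near F, piv (t p + k)%N = a k.
Proof.
by apply: filterS t_phase => p p0; rewrite (piv_cyclic a0) -modnDml p0 add0n.
Qed.

Lemma limit_process : exists Xs Vs : nat -> 'M[R[i]]_n,
  [/\ forall k, mlim F (fun p => Hs (t p + k)%N) (Xs k),
      forall k, [/\ (a k).1 != (a k).2, Vs k \is unitarymx,
        in_plane (a k).1 (a k).2 (Vs k) & Vs k (a k).1 (a k).1 != 0],
      forall k, Xs k.+1 = (Vs k)^t* *m Xs k *m Vs k &
      forall k, pivot0 (a k) (Xs k.+1)].
Proof.
have /choice[Xs XsP] k : exists X, mlim F (fun p => Hs (t p + k)%N) X.
  by apply: (mlim_bounded (M := M) UF) => p r s.
have /choice[Vs VsP] k : exists X, mlim F (fun p => Us (t p + k)%N) X.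
  by apply: (mlim_bounded (M := 1) UF) => p r s; apply: cmod_unitary_le1.
(* [Fs] and [Us] share their limits, so [Vs k] inherits unitarity from [Us], and from [Fs] the pivot
   plane and the lower bound on the diagonal entry. *)
have FsP k : mlim F (fun p => Fs (t p + k)%N) (Vs k).
  apply: mlim_sub0 (VsP k) => r s.
  exact: (@cvg_shift (fun k => cmod (Fs k r s - Us k r s))).
exists Xs, Vs; split=> // k.
- split.
  + by have [p pk] := filter_ex (near_piv k); rewrite -pk.
  + apply/unitarymxP.
    apply: (mlim_unique PF (mlimM _ (VsP k) (mlim_trmxC _ (VsP k)))).
    move=> r s; under eq_fun do rewrite (unitarymxP (Us_unitary _)).
    exact: clim_cst.
  + move=> r s rs; apply: (clim_unique PF (FsP k r s)).
    apply: clim_near_eq (clim_cst ((r == s)%:R : R[i]) _).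
    apply: filterS (near_piv k) => p pk; rewrite Fs_plane ?pk //.
  + have ck : c ^+ 2 <= cmod (Vs k (a k).1 (a k).1) ^+ 2.
      apply: (cvgr_to_ge (clim_cmod_sqr _ (FsP k _ _))).
      have : \forall p \near F, (T0 <= t p + k)%N.
        by have /(shift_infty k) := nbhs_infty_ge T0.
      apply: filterS2 (near_piv k) => p pk /Fs_diag; rewrite pk => cF.
      by rewrite ler_pXn2r // nnegrE ?cmod_ge0 // ltW.
    apply: contraTneq ck => ->; rewrite /cmod ComplexField.Normc.normc0 expr0n /=.
    by rewrite -ltNge exprn_gt0.
- apply: (mlim_unique PF (XsP k.+1)).
  apply: mlim_near_eq (mlimM _ (mlimM _ (mlim_trmxC _ (FsP k)) (XsP k)) (FsP k)).
  by apply: nearW => p; rewrite addnS HsS.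
- have X0 : Xs k.+1 (a k).1 (a k).2 = 0.
    apply: (clim_unique PF (XsP k.+1 _ _)).
    pose z p := let k' := (t p + k)%N in Hs k'.+1 (piv k').1 (piv k').2.
    apply: (@clim_near_eq _ _ z).
      by apply: filterS (near_piv k) => p pk; rewrite /z pk addnS.
    apply: clim_cmod0.
    exact: (@cvg_shift (fun k => cmod (Hs k.+1 (piv k).1 (piv k).2))).
  (* The limit matrices are Hermitian, which yields the second pivot entry. *)
  split=> //; have <- : (Xs k.+1)^t* = Xs k.+1.
    apply: (mlim_unique PF (mlim_trmxC _ (XsP k.+1))).
    by apply: mlim_near_eq (XsP k.+1); apply: nearW => p; rewrite Hs_herm.
  by rewrite trmxCE X0 conjC0.
Qed.

End UltraLimit.

Lemma process_off_norm_cvg0 : (fun k => off_norm (Hs k)) @ \oo --> (0 : R).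
Proof.
have u0M k : 0 <= off_sqr (Hs k) <= \sum_(r < n) \sum_(s < n | r != s) M ^+ 2.
  rewrite off_sqr_ge0; apply: ler_sum => r _; apply: ler_sum => s _.
  rewrite ler_pXn2r // nnegrE ?cmod_ge0 //.
  exact: le_trans (cmod_ge0 _) (Hs_bounded k r s).
have [s [s_ub s_lb]] := real_limsup u0M.
suff s0 : s <= 0.
  apply: off_norm_cvg0 => e /s_ub[T Te]; exists T => k /Te /le_trans; apply.
  by rewrite gerDr.
(* [kappa p] is an index beyond [p] where the off-diagonal mass nearly reaches its upper limit [s];
   it will be the right end of the window. *)
have /choice[kappa kappaP] p :
    exists k, (p <= k)%N /\ s - p.+1%:R^-1 < off_sqr (Hs k).
  by have [|k pk sk] := s_lb p.+1%:R^-1 p; [rewrite invr_gt0 ltr0n | exists k].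
have [F [UF ooF]] := ultraFilterLemma (F := \oo) _.
have PF := @ultra_proper _ _ UF.
have [rho rhoN kappa_rho] := ultra_modn kappa UF O_gt0.
have [m mP] := exact_process_off2_eq0 a0 O_diag.
(* Adding the residue [rho] to the [m] sweeps makes each window that ends at [kappa p] start at the
   beginning of a sweep. The truncated subtraction is exact along [F], where [kappa p] eventually
   exceeds [W]. *)
pose W := (m * size O + rho)%N; pose t p := (kappa p - W)%N.
have kappa_ge T : \forall p \near F, (T <= kappa p)%N.
  apply: ooF; exists T => // p /= Tp.
  by apply: leq_trans Tp _; have [] := kappaP p.
have t_infty : t @ F --> \oo.
  move=> A [T _ TA]; apply: filterS (kappa_ge (T + W)%N) => p TWp.
  by apply: TA; rewrite /= /t leq_subRL ?(leq_trans (leq_addl _ _) TWp) // addnC.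
have tW : \forall p \near F, (t p + W)%N = kappa p.
  by apply: filterS (kappa_ge W) => p Wp; rewrite subnK.
have t_phase : \forall p \near F, (t p %% size O)%N = 0%N.
  apply: filterS2 tW kappa_rho => p <- /eqP.
  rewrite /W addnCA modnMDl -[X in _ == X](modn_small rhoN).
  by rewrite -{2}[rho]add0n eqn_modDr mod0n => /eqP.
have [Xs [Vs [XsP VsP XsS Xs0]]] := limit_process UF t_infty t_phase.
have off_lim k : (fun p => off_sqr (Hs (t p + k)%N)) @ F --> off_sqr (Xs k).
  exact: mlim_off_sqr (XsP k).
have X0s : off_sqr (Xs 0%N) <= s.
  apply/ler_addgt0Pr => e e0; have [T Te] := s_ub e e0.
  apply: (cvgr_to_le (off_lim 0%N)).
  by apply: filterS (near_t_ge t_infty T) => p Tp; rewrite addn0; apply: Te.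
have XWs : s <= off_sqr (Xs W).
  apply/ler_addgt0Pr => e e0; rewrite -lerBlDr.
  apply: (cvgr_to_ge (off_lim W)).
  have : \forall p \near F, p.+1%:R^-1 < e.
    by apply: ooF; apply: (near_infty_natSinv_lt (PosNum e0)).
  apply: filterS2 tW => p -> pe; have [_ /ltW] := kappaP p.
  by apply: le_trans; rewrite lerB // ltW.
have : off2 (Xs W) = 0.
  apply: (mP W Xs Vs) => //; first exact: leq_addr.
  by rewrite !off2E lecR (le_trans X0s).
by rewrite off2E => -[XW0]; rewrite XW0 in XWs.
Qed.

End AsymptoticProcess.

Theorem theorem3p8 (R : realType) (n : nat) (H : 'M[R[i]]_n)
  (Hs Fs : nat -> 'M[R[i]]_n) (piv : nat -> 'I_n * 'I_n) :
  (2 <= n)%N -> H \is hermsymmx -> H != 0 ->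
  Hs 0%N = H ->
  (forall k, Hs k.+1 = (Fs k)^t* *m Hs k *m Fs k) ->
  (forall k, elem_plane (Fs k) (piv k).1 (piv k).2) ->
  (* (A1) *)
  (exists O : seq ('I_n * 'I_n), gen_serial O /\ cyclic_strategy O piv) ->
  (* (A2) *)
  (exists Us : nat -> 'M[R[i]]_n,
     (forall k, Us k \is unitarymx /\ exists p q : 'I_n, elem_plane (Us k) p q) /\
     (forall r s : 'I_n, (fun k => cmod (Fs k r s - Us k r s)) @ \oo --> (0 : R))) ->
  (* (A3) *)
  (0 < limn_einf (fun k => (cmod (Fs k (piv k).1 (piv k).1))%:E))%E ->
  (* (A4) *)
  (exists M : R, forall k (r s : 'I_n), cmod (Hs k r s) <= M) ->
  ((fun k => cmod (Hs k.+1 (piv k).1 (piv k).2)) @ \oo --> (0 : R) <->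
   (fun k => off_norm (Hs k)) @ \oo --> (0 : R)).
Proof.
move=> _ Hherm _ Hs0 HsS Fel [L [Lgen Lcyc]] [Us [UsP FsUs]] Fdiag [M HsM].
have neq k : (piv k).1 != (piv k).2.
  by have [ij _] := Fel k; apply: contraTneq ij => ->; rewrite ltnn.
split=> [piv0|off0]; last first.
  (* The easy direction: the pivot entry is off-diagonal, hence dominated by [off_norm] of the next
     iterate. *)
  apply: (squeeze_cvgr _ (cvg_cst 0)).
    by apply: nearW => k; rewrite cmod_ge0; apply: (cmod_le_off_norm _ (neq k)).
  by move: off0; rewrite -cvg_shiftS.
have LE : size L = (n * n.-1)./2.
  by case: Lgen => /perm_size -> _; rewrite size_pairs_n.
have [c c0 [T Tc]] := limn_einf_gt0 Fdiag.
apply: (@process_off_norm_cvg0 R n Hs Fs Us piv L M c T) => //.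
- elim=> [|k IH]; last by rewrite HsS hermitian_conj.
  rewrite Hs0; move: Hherm; rewrite is_hermitianmxE expr0 scale1r => /eqP.
  by move=> <-.
- by move=> k; have [_ []] := Fel k.
(* The strategy reads a pivot at position [0], so the ordering is nonempty. *)
- by have := Lcyc 0%N; rewrite mod0n; case: (L).
- by move=> a0 k; rewrite LE -odflt_onth -Lcyc.
- exact: gen_serial_forces_diag.
- by move=> k; have [] := UsP k.
Qed.
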